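(* Let $k$ and $i$ be integers with $1\le i\le k/2$, $k\equiv 2\pmod 3$ and $i\equiv 1\pmod 3$. Then for all integers $n\ge 0$, $$S_{k,i}(9n+3)\equiv S_{k,i}(9n+6)\equiv 0\pmod 4.$$
   Context: Write $(a;q)_\infty=\prod_{m\ge 0}(1-aq^m)$, $(a)_\infty=(a;q)_\infty$, and $(a_1,\ldots,a_r;q)_\infty=(a_1;q)_\infty\cdots(a_r;q)_\infty$. For integers $k,i$ with $1\le i\le k/2$, the integers $S_{k,i}(n)$, $n\ge 0$, are given by the generating function $$\sum_{n\ge 0}S_{k,i}(n)q^n=\frac{(-q)_\infty\,(q^i,q^{k-i},q^k;q^k)_\infty}{(q)_\infty}.$$ Combinatorially (an overpartition of $n$ is a partition of $n$ in which the first occurrence of each integer may be overlined): if $i<k/2$, $S_{k,i}(n)$ is the number of overpartitions of $n$ whose non-overlined parts are not congruent to $0,\pm i$ modulo $k$; if $i=k/2$, it is the number of overpartitions of $n$ with no part divisible by $k/2$. *)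

(* Defs.v *)
From mathcomp Require Import all_boot all_order all_algebra.

Set Implicit Arguments.
Unset Strict Implicit.
Unset Printing Implicit Defensive.

Import GRing.Theory.
Local Open Scope ring_scope.

(* Formal power series in q over the integers, as coefficient sequences;
   the indeterminate q is 'X on the polynomial side. *)
Definition fps := nat -> int.

Definition fps_one : fps := fun n => (n == 0%N)%:R.

Definition fps_mul (f g : fps) : fps :=
  fun n => \sum_(i < n.+1) f i * g (n - i)%N.

Definition fps_trunc (N : nat) (f : fps) : {poly int} := \poly_(i < N) f i.

(* 1 / f = \sum_j (1 - f)^j, meaningful when f has constant term 1; the terms
   with j > n and the coefficients of f beyond q^n do not contribute to the
   coefficient of q^n. See [fps_mulfV]. *)
Definition fps_inv (f : fps) : fps :=
  fun n => (\sum_(j < n.+1) (1 - fps_trunc n.+1 f) ^+ j)`_n.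

(* (a; b)_oo = \prod_(m >= 0) (1 - a b^m), meaningful when a and b have zero
   constant term: the factors with m > n do not contribute to the coefficient
   of q^n. See [qpochE]. *)
Definition qpoch (a b : {poly int}) : fps :=
  fun n => (\prod_(m < n.+1) (1 - a * b ^+ m))`_n.

Definition qpoch3 (a1 a2 a3 b : {poly int}) : fps :=
  fps_mul (fps_mul (qpoch a1 b) (qpoch a2 b)) (qpoch a3 b).

Definition overS (k i : nat) : fps :=
  fps_mul (fps_mul (qpoch (- 'X) 'X) (qpoch3 'X^i 'X^(k - i) 'X^k 'X^k))
          (fps_inv (qpoch 'X 'X)).

Lemma coef_fps_trunc N f n : (n < N)%N -> (fps_trunc N f)`_n = f n.
Proof. by move=> ltnN; rewrite coef_poly ltnN. Qed.

Lemma coef_mul_agree N (p p' r r' : {poly int}) :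
    (forall n, (n < N)%N -> p`_n = p'`_n) ->
    (forall n, (n < N)%N -> r`_n = r'`_n) ->
  forall n, (n < N)%N -> (p * r)`_n = (p' * r')`_n.
Proof.
move=> Ep Er n ltnN; rewrite !coefM; apply: eq_bigr => i _.
rewrite Ep ?Er //; first exact: leq_ltn_trans (leq_subr _ _) ltnN.
by apply: leq_trans ltnN; apply: ltn_ord.
Qed.

Lemma coef_exp_agree N (p p' : {poly int}) :
    (forall n, (n < N)%N -> p`_n = p'`_n) ->
  forall j n, (n < N)%N -> (p ^+ j)`_n = (p' ^+ j)`_n.
Proof.
move=> Ep; elim=> [|j IHj] n ltnN; first by rewrite !expr0.
by rewrite !exprS; apply: (@coef_mul_agree N).
Qed.

Lemma fps_mul_trunc N f g n : (n < N)%N ->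
  fps_mul f g n = (fps_trunc N f * fps_trunc N g)`_n.
Proof.
move=> ltnN; rewrite coefM; apply: eq_bigr => i _; rewrite !coef_fps_trunc //.
  exact: leq_ltn_trans (leq_subr _ _) ltnN.
by apply: leq_trans ltnN; apply: ltn_ord.
Qed.

Lemma fps_mulC f g : fps_mul f g =1 fps_mul g f.
Proof. by move=> n; rewrite !(@fps_mul_trunc n.+1) // mulrC. Qed.

Lemma eq_fps_mulr f g h : g =1 h -> fps_mul f g =1 fps_mul f h.
Proof. by move=> Egh n; apply: eq_bigr => i _; rewrite Egh. Qed.

Lemma fps_mulA f g h : fps_mul f (fps_mul g h) =1 fps_mul (fps_mul f g) h.
Proof.
move=> n; rewrite !(@fps_mul_trunc n.+1) //.
set p := fps_trunc n.+1; transitivity ((p f * (p g * p h))`_n).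
  apply: (@coef_mul_agree n.+1) => // m ltm.
  by rewrite coef_fps_trunc // (@fps_mul_trunc n.+1).
rewrite mulrA; apply: (@coef_mul_agree n.+1) => // m ltm.
by rewrite coef_fps_trunc // (@fps_mul_trunc n.+1).
Qed.

Lemma fps_mulf1 f : fps_mul f fps_one =1 f.
Proof.
move=> n; rewrite /fps_mul big_ord_recr /= subnn mulr1 big1 ?add0r // => i _.
by rewrite /fps_one subn_eq0 leqNgt ltn_ord mulr0.
Qed.

Lemma coef_exp0_lt (p : {poly int}) j n :
  p`_0 = 0 -> (n < j)%N -> (p ^+ j)`_n = 0.
Proof.
move=> p0; elim: j n => // j IHj n ltnj.
rewrite exprS coefM big1 // => -[[|i] lti] _ /=; first by rewrite p0 mul0r.
rewrite IHj ?mulr0 //; apply: leq_trans (_ : n <= j)%N => //.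
by case: n ltnj lti => // n _ _; rewrite subSS ltnS leq_subr.
Qed.

Lemma fps_invE N f n : f 0%N = 1 -> (n < N)%N ->
  fps_inv f n = (\sum_(j < N) (1 - fps_trunc N f) ^+ j)`_n.
Proof.
move=> f0 ltnN; rewrite /fps_inv !coef_sum.
rewrite (big_ord_widen N (fun j => ((1 - fps_trunc n.+1 f) ^+ j)`_n)) //.
rewrite big_mkcond; apply: eq_bigr => j _; case: ltnP => [_ | ltnj].
  apply: (@coef_exp_agree n.+1) => // m ltm.
  by rewrite !coefB !coef_fps_trunc //; apply: leq_trans ltnN.
rewrite coef_exp0_lt // coefB coef1 coef_fps_trunc ?f0 ?subrr //.
exact: leq_trans ltnN.
Qed.

Lemma fps_mulfV f : f 0%N = 1 -> fps_mul f (fps_inv f) =1 fps_one.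
Proof.
move=> f0 n; rewrite (@fps_mul_trunc n.+1) //; set p := fps_trunc n.+1 f.
transitivity ((p * \sum_(j < n.+1) (1 - p) ^+ j)`_n).
  apply: (@coef_mul_agree n.+1) => // m ltm.
  by rewrite coef_fps_trunc // (@fps_invE n.+1).
have -> : p * \sum_(j < n.+1) (1 - p) ^+ j = 1 - (1 - p) ^+ n.+1.
  by apply: oppr_inj; rewrite opprB subrX1 -mulNr addrAC subrr add0r.
rewrite coefB coef1 coef_exp0_lt ?subr0 //.
by rewrite coefB coef1 coef_fps_trunc // f0 subrr.
Qed.

Lemma qpochE (a b : {poly int}) N n : a`_0 = 0 -> b`_0 = 0 -> (n < N)%N ->
  (\prod_(m < N) (1 - a * b ^+ m))`_n = qpoch a b n.
Proof.
move=> a0 b0; elim: N => // N IHN; rewrite ltnS leq_eqVlt.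
case/predU1P=> [-> // | ltnN].
rewrite big_ord_recr /= mulrBr mulr1 coefB IHN // [X in _ - X]coefM.
rewrite [X in _ - X]big1 ?subr0 // => j _.
rewrite [X in _ * X]coefM [X in _ * X]big1 ?mulr0 // => -[[|l] ltl] _ /=.
  by rewrite a0 mul0r.
rewrite coef_exp0_lt ?mulr0 //; apply: leq_ltn_trans ltnN.
by rewrite (leq_trans (leq_subr _ _)) ?leq_subr.
Qed.

Lemma overS_gf k i :
  fps_mul (qpoch 'X 'X) (overS k i) =1
  fps_mul (qpoch (- 'X) 'X) (qpoch3 'X^i 'X^(k - i) 'X^k 'X^k).
Proof.
have E0 : qpoch 'X 'X 0%N = 1.
  by rewrite /qpoch big_ord1 expr0 mulr1 coefB coef1 coefX subr0.
move=> n; rewrite fps_mulC /overS -fps_mulA -[RHS]fps_mulf1.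
apply: eq_fps_mulr => m; rewrite fps_mulC; exact: fps_mulfV.
Qed.

(* Main.v *)
(** Modulo 4, (1 + y) / (1 - y) = 1 + 2 (y + y^2 + ...) gives
    (-q)_oo / (q)_oo = 1 + 2 sum_(m, t >= 1) q^(m t), and pairing (m, t) with
    (t, m) leaves 1 + 2 sum_(m >= 1) q^(m^2). By the Jacobi triple product the
    other factor is a signed sum of q^(k j(j-1)/2 + i j) over all integers j.
    When k = 2 and i = 1 mod 3 these exponents are congruent to j^2 mod 3, and
    divisible by 9 if 3 divides j, so that, like squares, they are 0, 1, 4 or 7
    mod 9. No sum of two such residues is 3 or 6 mod 9.

    The triple product is the limit of the q-binomial theorem; limits are
    handled as congruences of polynomials modulo (d, X^N). *)

Require Import Defs.
From mathcomp Require Import all_boot all_order all_algebra.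
From mathcomp Require Import zify ring.

Set Implicit Arguments.
Unset Strict Implicit.
Unset Printing Implicit Defensive.

Import GRing.Theory.
Local Open Scope ring_scope.

(** * Gaussian binomials and the finite Jacobi triple product *)

Section GaussBinomial.

Variable R : comNzRingType.
Implicit Types Q x y : R.

(** The Gaussian binomials, given by their Pascal recurrence so that no division is required. For
    [r' > m'] the truncated exponent [m' - r'] is harmless, as it multiplies 0. *)
Fixpoint gauss_bin Q (m r : nat) : R :=
  match m, r with
  | _, 0%N => 1
  | 0%N, _.+1 => 0
  | m'.+1, r'.+1 => gauss_bin Q m' r'.+1 + Q ^+ (m' - r') * gauss_bin Q m' r'
  end.

Definition qfact Q (m : nat) : R := \prod_(j < m) (1 - Q * Q ^+ j).

Lemma gauss_bin0 Q m : gauss_bin Q m 0 = 1.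
Proof. by case: m. Qed.

Lemma gauss_binS Q m r :
  gauss_bin Q m.+1 r.+1 = gauss_bin Q m r.+1 + Q ^+ (m - r) * gauss_bin Q m r.
Proof. by []. Qed.

Lemma gauss_bin_small Q m r : (m < r)%N -> gauss_bin Q m r = 0.
Proof.
elim: m r => [|m IHm] [|r] //; rewrite ltnS => ltmr.
by rewrite gauss_binS !IHm ?mulr0 ?addr0 // ltnW.
Qed.

Lemma qfactS Q m : qfact Q m.+1 = qfact Q m * (1 - Q ^+ m.+1).
Proof. by rewrite /qfact big_ord_recr /= exprS. Qed.

(** The quotient formula for Gaussian binomials with denominators cleared. *)
Lemma gauss_bin_qfact Q m r : (r <= m)%N ->
  gauss_bin Q m r * qfact Q r * qfact Q (m - r) = qfact Q m.
Proof.
have E0 : qfact Q 0 = 1 by rewrite /qfact big_ord0.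
elim: m r => [|m IHm] [|r] //; rewrite ?gauss_bin0 ?E0 ?subn0 ?mulr1 ?mul1r //.
rewrite ltnS subSS leq_eqVlt => /predU1P[-> | ltrm].
  have := IHm m (leqnn m); rewrite subnn E0 !mulr1 => Em.
  by rewrite gauss_binS gauss_bin_small // subnn expr0 add0r mul1r qfactS mulrA Em.
have E1 := IHm r.+1 ltrm; have E2 := IHm r (ltnW ltrm).
have [d def_d] : exists d, (m - r)%N = d.+1 by exists (m - r.+1)%N; lia.
have def_d' : (m - r.+1)%N = d by lia.
rewrite def_d' in E1; rewrite def_d in E2.
(* This splitting of [1 - Q ^+ m.+1] mirrors the two terms of the Pascal recurrence. *)
have -> : (qfact Q m.+1 = (1 - Q ^+ d.+1) * qfact Q m
             + Q ^+ d.+1 * (1 - Q ^+ r.+1) * qfact Q m).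
  rewrite qfactS; have -> : (m.+1 = d.+1 + r.+1)%N by lia.
  by rewrite exprD; ring.
rewrite -{1}E1 -E2 gauss_binS def_d !qfactS; ring.
Qed.

(** Multiplying by the last factor [y + x * Q ^+ m] splits the sum in two, and Pascal merges the
    shifted halves. Being homogeneous in [x] and [y], this form allows [y = Q ^+ N] without
    division. *)
Lemma q_binomial Q x y m :
  \prod_(j < m) (y + x * Q ^+ j) =
  \sum_(r < m.+1) Q ^+ 'C(r, 2) * gauss_bin Q m r * x ^+ r * y ^+ (m - r).
Proof.
elim: m => [|m IHm]; first by rewrite big_ord0 big_ord1 /= !mulr1.
rewrite big_ord_recr /= {}IHm mulrDr !big_distrl /=.
rewrite [RHS]big_ord_recl [X in _ = _ + X]big_ord_recr /=.
rewrite [X in X + _ = _]big_ord_recl [X in _ + X = _]big_ord_recr /=.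
rewrite !add0n !gauss_bin0 !subn0 !expr0 subnn !mulr1 !mul1r.
rewrite [gauss_bin Q m m.+1]gauss_bin_small // add0r subnn expr0 mulr1.
rewrite -exprSr -!addrA; congr (_ + _).
rewrite addrA -big_split /=; congr (_ + _).
  apply: eq_bigr => r _; rewrite /bump /= !add1n.
  have ltrm := ltn_ord r.
  have -> : (m.+1 - r.+1 = (m - r.+1).+1)%N by lia.
  have -> : (m - r = (m - r.+1).+1)%N by lia.
  have def_m : (m = r + (m - r.+1).+1)%N by lia.
  rewrite [X in x * Q ^+ X]def_m binS bin1 !exprD !exprS; ring.
by rewrite binS bin1 exprD exprS; ring.
Qed.

End GaussBinomial.

(* The general term [Q^(j(j-1)/2) z^j] of the theta series at [j = r - N]; as
   [w = Q / z], the case [j = -s < 0] reads [Q^(s(s-1)/2) w^s]. *)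
Definition theta_term (R : nzRingType) (Q z w : R) (N r : nat) : R :=
  if (N <= r)%N then Q ^+ 'C(r - N, 2) * z ^+ (r - N)
  else Q ^+ 'C(N - r, 2) * w ^+ (N - r).

Lemma binD2 m n : 'C(m + n, 2) = ('C(m, 2) + 'C(n, 2) + m * n)%N.
Proof.
elim: m => [|m IHm]; first by rewrite mul0n addn0.
rewrite addSn !binS !bin1 IHm mulSn; lia.
Qed.

Lemma prod_exp_ord (R : comNzRingType) (Q : R) N :
  \prod_(j < N) Q ^+ j = Q ^+ 'C(N, 2).
Proof.
elim: N => [|N IHN]; first by rewrite big_ord0.
by rewrite big_ord_recr /= IHN binS bin1 exprD.
Qed.

(* The [q]-binomial theorem at [y = Q^N] and [x = - z], divided by the
   prefactor [Q^(N(N-1)/2 + N^2) (- z)^N]. *)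
Lemma finite_jacobi (R : idomainType) (z w : R) N : z * w != 0 ->
  let Q := z * w in
  (\prod_(m < N) (1 - z * Q ^+ m)) * (\prod_(m < N) (1 - w * Q ^+ m)) =
  \sum_(r < (2 * N).+1)
     (-1) ^+ (N + r) * gauss_bin Q (2 * N) r * theta_term Q z w N r.
Proof.
move=> nzQ Q; have nzz : z != 0 by apply: contraNneq nzQ => ->; rewrite mul0r.
apply: (@mulfI _ (Q ^+ ('C(N, 2) + N * N) * (- z) ^+ N)).
  by rewrite mulf_neq0 // expf_neq0 ?oppr_eq0.
(* For [j < N], [Q^N - z Q^j = - z Q^j (1 - w Q^(N-j-1))] yields the product in [w], reversed; the
   factors with [j >= N] yield the product in [z]. *)
transitivity (\prod_(j < 2 * N) (Q ^+ N + - z * Q ^+ j)).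
  have -> : (2 * N = N + N)%N by lia.
  rewrite big_split_ord /=.
  under [X in _ = _ * X]eq_bigr => j _.
    rewrite exprD (_ : _ + _ = Q ^+ N * (1 - z * Q ^+ j)); last by ring.
    over.
  rewrite big_split /= prodr_const card_ord -exprM.
  have -> : \prod_(j < N) (Q ^+ N + - z * Q ^+ j) =
      \prod_(j < N) (Q ^+ j * (- z * (1 - w * Q ^+ (N - j.+1)))).
    apply: eq_bigr => j _; have ltjN := ltn_ord j.
    have {1}-> : (N = j + (N - j.+1).+1)%N by lia.
    by rewrite exprD exprS /Q; ring.
  rewrite big_split /= prod_exp_ord big_split /= prodr_const card_ord.
  have -> : \prod_(j < N) (1 - w * Q ^+ (N - j.+1)) =
            \prod_(j < N) (1 - w * Q ^+ j).
    rewrite (reindex_inj rev_ord_inj); apply: eq_bigr => j _ /=.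
    by have ltjN := ltn_ord j; have -> : (N - (N - j.+1).+1 = j)%N by lia.
  by rewrite exprD; ring.
rewrite q_binomial mulr_sumr; apply: eq_bigr => -[r /= ltr] _.
(* Signs and Gaussian binomials match; what remains is to recentre the exponents at [r = N]. *)
suff E : Q ^+ 'C(r, 2) * Q ^+ (N * (2 * N - r)) * z ^+ r =
         Q ^+ ('C(N, 2) + N * N) * z ^+ N * theta_term Q z w N r.
  rewrite -exprM !(exprNn z).
  transitivity ((-1) ^+ r * gauss_bin Q (2 * N) r *
    (Q ^+ 'C(r, 2) * Q ^+ (N * (2 * N - r)) * z ^+ r)); first by ring.
  rewrite E (exprD (-1)).
  have := sqrr_sign R N; move: ((-1) ^+ N) => e sq_e.
  by rewrite -[LHS]mul1r -{1}sq_e; ring.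
rewrite /theta_term; case: leqP => [leNr | ltrN].
  have [j def_r] : exists j, r = (N + j)%N by exists (r - N)%N; lia.
  have -> : (r - N = j)%N by lia.
  rewrite -exprD (_ : ('C(r, 2) + _ = 'C(N, 2) + N * N + 'C(j, 2))%N).
    by rewrite def_r !exprD; ring.
  rewrite def_r binD2; have -> : (2 * N - (N + j) = N - j)%N by lia.
  have lejN : (j <= N)%N by lia.
  rewrite mulnBr; have : (N * j <= N * N)%N by rewrite leq_mul2l lejN orbT.
  lia.
have [s def_N] : exists s, N = (r + s)%N by exists (N - r)%N; lia.
have -> : (N - r = s)%N by lia.
(* The extra [Q^s = z^s w^s] turns [z^r] into [z^N w^s]. *)
rewrite -exprD (_ : 'C(r, 2) + _ = 'C(N, 2) + N * N + 'C(s, 2) + s)%N.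
  by rewrite [in z ^+ N]def_N !exprD /Q !exprMn; ring.
have sq_s : (s * s = 2 * 'C(s, 2) + s)%N.
  by elim: s {def_N} => // s IHs; rewrite binS bin1; lia.
have -> : (2 * N - r = N + s)%N by lia.
rewrite mulnDr [X in (X * s)%N]def_N mulnDl sq_s [in 'C(N, 2)]def_N binD2; lia.
Qed.

(** * Congruences modulo the ideal (d, X^N) *)

Definition congr_low (d : int) (N : nat) (p r : {poly int}) : Prop :=
  forall n, (n < N)%N -> (d %| p`_n - r`_n)%Z.

Section CongrLow.

Variables (d : int) (N : nat).
Implicit Types p r u v : {poly int}.

Lemma congr_low_refl p : congr_low d N p p.
Proof. by move=> n _; rewrite subrr dvdz0. Qed.

Lemma congr_low_sym p r : congr_low d N p r -> congr_low d N r p.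
Proof. by move=> E n ltn; rewrite -opprB rpredN E. Qed.

Lemma congr_low_trans p r u :
  congr_low d N p r -> congr_low d N r u -> congr_low d N p u.
Proof.
move=> Epr Eru n ltn; rewrite -(subrKA r`_n).
by rewrite rpredD ?Epr ?Eru.
Qed.

Lemma congr_lowM p p' r r' :
  congr_low d N p p' -> congr_low d N r r' -> congr_low d N (p * r) (p' * r').
Proof.
move=> Ep Er n ltn; rewrite !coefM -sumrB; apply: rpred_sum => -[i /= lti] _.
have -> : p`_i * r`_(n - i) - p'`_i * r'`_(n - i) =
  (p`_i - p'`_i) * r`_(n - i) + p'`_i * (r`_(n - i) - r'`_(n - i)) by ring.
apply: rpredD; first by apply/dvdz_mulr/Ep; lia.
by apply/dvdz_mull/Er; lia.
Qed.

Lemma congr_low_sum (I : finType) (F G : I -> {poly int}) :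
  (forall i, congr_low d N (F i) (G i)) ->
  congr_low d N (\sum_i F i) (\sum_i G i).
Proof.
by move=> E n ltn; rewrite !coef_sum -sumrB; apply: rpred_sum => i _; apply: E.
Qed.

Lemma congr_low_prod (I : finType) (F G : I -> {poly int}) :
  (forall i, congr_low d N (F i) (G i)) ->
  congr_low d N (\prod_i F i) (\prod_i G i).
Proof.
move=> E; elim/big_rec2: _ => [|i p r _ Epr]; first exact: congr_low_refl.
exact: congr_lowM.
Qed.

(** Coefficient [n] of [p (u - v)] is that of [u - v] plus a combination of lower ones, so strong
    induction cancels [p] without inverting it. *)
Lemma congr_low_mulI p u v : p`_0 = 1 ->
  congr_low d N (p * u) (p * v) -> congr_low d N u v.
Proof.
move=> p0 E; elim/ltn_ind => n IHn ltn.
have := E n ltn; rewrite !coefM -sumrB big_ord_recl /= p0 !mul1r subn0.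
rewrite rpredDr //; apply: rpred_sum => i _; rewrite -mulrBr dvdz_mull //.
by have lti := ltn_ord i; apply: IHn; rewrite /bump /=; lia.
Qed.

Lemma congr_low_poly (f : nat -> int) p :
  (forall n, (n < N)%N -> f n = p`_n) -> congr_low d N (fps_trunc N f) p.
Proof. by move=> E n ltn; rewrite coef_fps_trunc // E // subrr dvdz0. Qed.

Lemma congr_lowXM (e : nat) p r s :
  p = r + 'X^e * s -> (N <= e)%N -> congr_low d N p r.
Proof.
move=> -> leNe n ltn; rewrite coefD coefXnM (leq_trans ltn leNe) addr0.
by rewrite subrr dvdz0.
Qed.

End CongrLow.

Lemma congr_low_mulXn d N M e p r : (N <= e + M)%N ->
  congr_low d M p r -> congr_low d N ('X^e * p) ('X^e * r).
Proof.
move=> leN E n ltn; rewrite !coefXnM; case: ltnP => [|leen].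
  by rewrite subrr dvdz0.
by apply: E; lia.
Qed.

(** * The Jacobi triple product *)

Section JacobiTripleProduct.

Variables (d : int) (k : nat).
Hypothesis k_gt0 : (0 < k)%N.

Let Q : {poly int} := 'X^k.

Lemma qfact_coef0 m : (qfact Q m)`_0 = 1.
Proof.
elim: m => [|m IHm]; first by rewrite /qfact big_ord0 coef1.
by rewrite qfactS coef0M IHm coefB coef1 -exprM coefXn mul1r; case: k k_gt0.
Qed.

Lemma congr_qfact m n : (m <= n)%N ->
  congr_low d (k * m.+1) (qfact Q n) (qfact Q m).
Proof.
elim: n => [|n IHn]; first by rewrite leqn0 => /eqP->; apply: congr_low_refl.
rewrite leq_eqVlt => /predU1P[-> | ltmn]; first exact: congr_low_refl.
apply: congr_low_trans (IHn ltmn).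
apply: (@congr_lowXM _ _ (k * n.+1) _ _ (- qfact Q n)).
  by rewrite qfactS /Q -exprM; ring.
by rewrite leq_mul2l ltmn orbT.
Qed.

(** The Gaussian binomial tends to [1 / (Q; Q)_oo]. With [a <= N <= b] the minimum and maximum of
    [r] and [2N - r], it is the quotient of [(Q)_(2N)] by [(Q)_a (Q)_b], and all these q-factorials
    agree with [(Q)_N] below degree [k (a + 1)]. *)
Lemma congr_gauss_bin_qfact N r : (r <= 2 * N)%N ->
  congr_low d (k * (minn r (2 * N - r)).+1)
    (gauss_bin Q (2 * N) r * qfact Q N) 1.
Proof.
move=> ler; have EG := gauss_bin_qfact Q ler.
set a := minn r (2 * N - r); set b := maxn r (2 * N - r).
have leaN : (a <= N)%N by rewrite /a; lia.
have leab : (a <= b)%N by rewrite /a /b; lia.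
have {}EG : qfact Q b * (gauss_bin Q (2 * N) r * qfact Q a) = qfact Q (2 * N).
  rewrite -EG /a /b; case: (leqP r (2 * N - r)) => [le_r | lt_r].
    by ring.
  by ring.
apply: (congr_low_mulI (qfact_coef0 b)); rewrite mulr1.
apply: (@congr_low_trans _ _ _ (qfact Q (2 * N))).
  rewrite -EG; apply: congr_lowM; first exact: congr_low_refl.
  by apply: congr_lowM; [apply: congr_low_refl | apply: congr_qfact].
apply: congr_low_trans (congr_low_sym (congr_qfact leab)).
by apply: congr_qfact; lia.
Qed.

(** The exponent [k j(j-1)/2 + i j] at [j = r - N], written for [j = -s < 0] as
    [k s(s-1)/2 + (k - i) s]. *)
Definition theta_exp (i N r : nat) : nat :=
  (if N <= r then k * 'C(r - N, 2) + i * (r - N)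
   else k * 'C(N - r, 2) + (k - i) * (N - r))%N.

Lemma theta_termXn i N r :
  theta_term Q 'X^i 'X^(k - i) N r = 'X^(theta_exp i N r).
Proof.
by rewrite /theta_term /theta_exp /Q; case: ifP; rewrite exprD !exprM.
Qed.

Lemma jacobi_triple i N : (0 < i < k)%N ->
  congr_low d N
    ((\prod_(m < N) (1 - 'X^i * Q ^+ m)) *
     (\prod_(m < N) (1 - 'X^(k - i) * Q ^+ m)) *
     (\prod_(m < N) (1 - Q * Q ^+ m)))
    (\sum_(r < (2 * N).+1) (-1) ^+ (N + r) * 'X^(theta_exp i N r)).
Proof.
case/andP=> lt0i ltik.
have zwQ : 'X^i * 'X^(k - i) = Q by rewrite -exprD subnKC // ltnW.
have nzQ : 'X^i * 'X^(k - i) != 0 :> {poly int}.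
  by rewrite zwQ /Q monic_neq0 ?monicXn.
have /= := finite_jacobi N nzQ; rewrite zwQ => ->.
rewrite mulr_suml; apply: congr_low_sum => -[r /= ltr].
rewrite theta_termXn.
have -> : (-1) ^+ (N + r) * gauss_bin Q (2 * N) r * 'X^(theta_exp i N r) *
    \prod_(m < N) (1 - Q * Q ^+ m) =
  (-1) ^+ (N + r) *
    ('X^(theta_exp i N r) * (gauss_bin Q (2 * N) r * qfact Q N)).
  by rewrite /qfact; ring.
apply: congr_lowM; first exact: congr_low_refl.
rewrite -[X in congr_low _ _ _ X]mulr1; have ler : (r <= 2 * N)%N by [].
(* Far from [r = N] the approximation of the Gaussian binomial is poor, but [theta_exp >= |r - N|]
   and [min(r, 2N - r) = N - |r - N|], so the precisions add up to at least [N]. *)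
apply: congr_low_mulXn (congr_gauss_bin_qfact ler).
have kP := leq_pmull (minn r (2 * N - r)).+1 k_gt0.
rewrite /theta_exp; case: (leqP N r) => [leNr | ltrN].
  by have := leq_pmull (r - N) lt0i; move: (k * 'C(_, _))%N => c; lia.
have lt0ki : (0 < k - i)%N by lia.
by have := leq_pmull (N - r) lt0ki; move: (k * 'C(_, _))%N => c; lia.
Qed.

End JacobiTripleProduct.

Lemma congr_qpoch d N (a b : {poly int}) : a`_0 = 0 -> b`_0 = 0 ->
  congr_low d N (fps_trunc N (qpoch a b)) (\prod_(m < N) (1 - a * b ^+ m)).
Proof. by move=> a0 b0; apply: congr_low_poly => n ltn; rewrite qpochE. Qed.

Lemma congr_fps_mul d N f g p r :
    congr_low d N (fps_trunc N f) p -> congr_low d N (fps_trunc N g) r ->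
  congr_low d N (fps_trunc N (fps_mul f g)) (p * r).
Proof.
move=> Ef Eg; apply: congr_low_trans (congr_lowM Ef Eg).
by apply: congr_low_poly => n; apply: fps_mul_trunc.
Qed.

(** * The overpartition function modulo 4 *)

Lemma prod_1D2 (R : comNzRingType) (I : finType) (u : I -> R) :
  exists s, \prod_i (1 + 2%:R * u i) = 1 + 2%:R * \sum_i u i + 4%:R * s.
Proof.
elim/big_rec2: _ => [|i p r _ [s ->]]; first by exists 0; ring.
by exists (s + u i * p + 2%:R * u i * s); ring.
Qed.

Lemma sum_sym (R : comNzRingType) (F : nat -> nat -> R) N :
    (forall m n, F m n = F n m) ->
  exists s, \sum_(m < N) \sum_(n < N) F m n = \sum_(m < N) F m m + 2%:R * s.
Proof.
move=> symF; elim: N => [|N [s IHN]].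
  by exists 0; rewrite !big_ord0 mulr0 addr0.
exists (s + \sum_(m < N) F m N); rewrite !big_ord_recr /=.
under eq_bigr => m _ do rewrite big_ord_recr /=.
rewrite big_split /= IHN; under [X in _ + (X + _)]eq_bigr => m _ do rewrite symF.
by ring.
Qed.

Lemma congr_overpartition N :
  congr_low 4 N (\prod_(m < N) (1 - (- 'X) * 'X ^+ m))
    ((\prod_(m < N) (1 - 'X * 'X ^+ m)) *
     (1 + 2%:R * \sum_(m < N) 'X^(m.+1 ^ 2))).
Proof.
(* [u m] truncates [y / (1 - y)] at [y = X^(m+1)]. The error [2 y^(N+1)] in
   [1 + y = (1 - y) (1 + 2 u)] has degree above [N]. *)
pose u (m : 'I_N) : {poly int} := \sum_(t < N) 'X^(m.+1 * t.+1).
apply: (@congr_low_trans _ _ _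
  (\prod_(m < N) (1 - 'X * 'X ^+ m) * \prod_(m < N) (1 + 2%:R * u m))).
  rewrite -big_split /=; apply: congr_low_prod => m.
  pose y : {poly int} := 'X^(m.+1).
  have Eu : (1 - y) * u m = y - y ^+ N.+1.
    rewrite /u; under eq_bigr => t _ do rewrite exprM exprS.
    rewrite -mulr_sumr -/y mulrCA.
    have := subrX1 y N; rewrite -[X in X = _]opprK opprB => E.
    rewrite (_ : (1 - y) * _ = 1 - y ^+ N) ?exprS; first by ring.
    by rewrite -[LHS]opprK -mulNr opprB -E opprK.
  apply: (@congr_low_trans _ _ _ (1 + y - 2%:R * y ^+ N.+1)).
    apply: congr_low_sym.
    apply: (@congr_lowXM _ _ (m.+1 * N.+1) _ _ (- 2%:R)); last by nia.
    by rewrite exprM mulNr -exprS /y; ring.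
  rewrite -exprS -/y (_ : (1 - y) * _ = 1 + y - 2%:R * y ^+ N.+1).
    exact: congr_low_refl.
  transitivity (1 - y + 2%:R * ((1 - y) * u m)); first by ring.
  by rewrite Eu; ring.
apply: congr_lowM; first exact: congr_low_refl.
have [s ->] := prod_1D2 u.
(* Off-diagonal terms pair up, so twice the double sum is twice its diagonal modulo 4. *)
have [|t ->] := @sum_sym _ (fun m t => 'X^(m.+1 * t.+1) : {poly int}) N.
  by move=> m n; rewrite mulnC.
move=> n _; rewrite (_ : _ + _ = 1 + 2%:R * \sum_(m < N) 'X^(m.+1 ^ 2)
  + (t + s) *+ 4).
  by rewrite coefD addrAC subrr add0r coefMn -[X in (_ %| X)%Z]mulr_natr dvdz_mull.
by rewrite -mulr_natl; under [in RHS]eq_bigr => m _ do rewrite -mulnn; ring.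
Qed.

(** * Exponents modulo 9 *)

Definition square_class9 (n : nat) : bool := (n %% 9)%N \in [:: 0; 1; 4; 7]%N.

(** If 3 divides [j], then 9 divides both [j^2] and [3 u]; otherwise [n] is 1 modulo 3, that is 1, 4
    or 7 modulo 9. *)
Lemma square_class9P j u n :
  (n = j ^ 2 + 3 * u)%N -> (3 %| j -> 3 %| u)%N -> square_class9 n.
Proof.
move=> def_n dvu; rewrite /square_class9 !inE.
have [dvj | ndvj] := boolP (3 %| j)%N.
  have /dvdnP[v def_u] := dvu dvj; case/dvdnP: dvj => t def_j.
  have : (n = 9 * (t * t + v))%N by rewrite def_n def_j def_u; nia.
  lia.
have : (n %% 3 = 1)%N.
  rewrite def_n; have [t [->|->]] : exists t, j = (3 * t + 1)%N \/ j = (3 * t + 2)%N.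
  - by exists (j %/ 3)%N; lia.
  - have -> : ((3 * t + 1) ^ 2 + 3 * u = 3 * (3 * t * t + 2 * t + u) + 1)%N by nia.
    lia.
  have -> : ((3 * t + 2) ^ 2 + 3 * u = 3 * (3 * t * t + 4 * t + 1 + u) + 1)%N by nia.
  lia.
lia.
Qed.

Lemma square_class9_sqr j : square_class9 (j ^ 2).
Proof. by apply: (@square_class9P j 0); rewrite ?muln0 ?addn0. Qed.

Lemma square_class9_bin k i j : k = 2 %[mod 3] -> i = 1 %[mod 3] ->
  square_class9 (k * 'C(j, 2) + i * j).
Proof.
move=> hk hi; have [k' ->] : exists k', k = (3 * k' + 2)%N.
  by exists (k %/ 3)%N; lia.
have [i' ->] : exists i', i = (3 * i' + 1)%N by exists (i %/ 3)%N; lia.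
have sq_j : (j * j = 2 * 'C(j, 2) + j)%N.
  by elim: j => // j IHj; rewrite binS bin1; lia.
(* The part of the exponent free of [k'] and [i'] is [2 C(j,2) + j = j^2]. *)
apply: (@square_class9P j (k' * 'C(j, 2) + i' * j)).
  by rewrite -mulnn sq_j; lia.
move=> dvj; apply: dvdn_add; apply: dvdn_mull => //.
by case/dvdnP: dvj sq_j => t ->; nia.
Qed.

(** Since [k - i] is also 1 modulo 3, both branches of [theta_exp] have the same shape. *)
Lemma square_class9_theta k i N r : (i <= k)%N ->
  k = 2 %[mod 3] -> i = 1 %[mod 3] -> square_class9 (theta_exp k i N r).
Proof.
by move=> leik hk hi; rewrite /theta_exp; case: ifP => _;
  apply: square_class9_bin => //; lia.
Qed.

Lemma coefM_square_class9 (p r : {poly int}) n :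
    (forall m, ~~ square_class9 m -> p`_m = 0) ->
    (forall m, ~~ square_class9 m -> r`_m = 0) ->
  (n %% 9)%N \in [:: 3; 6]%N -> (p * r)`_n = 0.
Proof.
move=> Sp Sr n36; rewrite coefM big1 // => -[m /= ltm] _.
have [Sm | /Sp->] := boolP (square_class9 m); last by rewrite mul0r.
rewrite Sr ?mulr0 //; move: n36 Sm; rewrite /square_class9 !inE; lia.
Qed.

(** * Divisibility of the coefficients by 4 *)

Lemma dvd4_overS k i n : (1 <= i)%N -> (2 * i <= k)%N ->
    k = 2 %[mod 3] -> i = 1 %[mod 3] -> (n %% 9)%N \in [:: 3; 6]%N ->
  (4 %| overS k i n)%Z.
Proof.
move=> lt0i le2ik hk hi n36; have ltik : (i < k)%N by lia.
have XnC0 e : (0 < e)%N -> ('X^e : {poly int})`_0 = 0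
  by case: e => // e; rewrite coefXn.
have X0 : ('X : {poly int})`_0 = 0 by rewrite coefX.
pose N := n.+1.
pose A : {poly int} := \prod_(m < N) (1 - 'X * 'X ^+ m).
pose D : {poly int} := 1 + 2%:R * \sum_(m < N) 'X^(m.+1 ^ 2).
pose T : {poly int} := \sum_(r < (2 * N).+1) (-1) ^+ (N + r) * 'X^(theta_exp k i N r).
have A0 : A`_0 = 1.
  by have := @qfact_coef0 1 isT N; rewrite /qfact expr1.
(* [A] truncates [(q)_oo], the denominator of the generating function; it also appears in the
   congruence for [(-q)_oo], and having constant term 1 it cancels. *)
have E : congr_low 4 N (A * fps_trunc N (overS k i)) (A * (D * T)).
  apply: (@congr_low_trans _ _ _ (fps_trunc N (fps_mul (qpoch 'X 'X) (overS k i)))).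
    apply: congr_low_sym; apply: congr_fps_mul; last exact: congr_low_refl.
    exact: congr_qpoch.
  apply: (@congr_low_trans _ _ _ (fps_trunc N (fps_mul (qpoch (- 'X) 'X)
            (qpoch3 'X^i 'X^(k - i) 'X^k 'X^k)))).
    by apply: congr_low_poly => m ltm; rewrite coef_fps_trunc ?overS_gf.
  rewrite mulrA; apply: congr_fps_mul.
    apply: congr_low_trans (@congr_overpartition N).
    by apply: congr_qpoch; rewrite ?coefN ?X0 ?oppr0.
  have k_gt0 : (0 < k)%N by lia.
  apply: congr_low_trans (@jacobi_triple 4 k k_gt0 i N _); last by rewrite lt0i.
  by apply: congr_fps_mul; [apply: congr_fps_mul|]; apply: congr_qpoch;
    apply: XnC0; lia.
have := congr_low_mulI A0 E (ltnSn n); rewrite coef_fps_trunc //.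
rewrite coefM_square_class9 ?subr0 // => m Sm.
  rewrite /D coefD coef1 mulr_natl coefMn coef_sum big1 => [|t _].
    by rewrite mul0rn addr0; case: m Sm.
  by rewrite coefXn; case: eqP Sm => // ->; rewrite square_class9_sqr.
rewrite /T coef_sum big1 // => r _.
have E0 : ('X^(theta_exp k i N r) : {poly int})`_m = 0.
  by rewrite coefXn; case: eqP Sm => // ->; rewrite square_class9_theta // ltnW.
by rewrite -signr_odd mulr_sign; case: ifP; rewrite ?coefN E0 ?oppr0.
Qed.

Local Close Scope ring_scope.

Theorem mainTheorem1 (k i : nat) (hi : (1 <= i)%N) (hik : (2 * i <= k)%N)
    (hk3 : k = 2 %[mod 3]) (hi3 : i = 1 %[mod 3]) (n : nat) :
  (overS k i (9 * n + 3)%N = overS k i (9 * n + 6)%N %[mod 4])%Z /\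
  (overS k i (9 * n + 6)%N = 0 %[mod 4])%Z.
Proof.
have /dvdz_mod0P E3 : (4 %| overS k i (9 * n + 3)%N)%Z.
  by apply: dvd4_overS => //; rewrite mulnC modnMDl.
have /dvdz_mod0P E6 : (4 %| overS k i (9 * n + 6)%N)%Z.
  by apply: dvd4_overS => //; rewrite mulnC modnMDl.
by rewrite E3 E6 mod0z.
Qed.
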